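(* Let $G=H\rtimes\mathbb{Z}^n$, and suppose $G$ acts simplicially on a tree $X$. Assume the action is cobounded, and either oriented lineal or quasi-parabolic. Assume the Busemann pseudocharacter associated to this action sends $H$ to $0$, and so induces a (non-trivial) character $\rho\colon\mathbb{Z}^n\to\mathbb{R}$. Then $\rho$ is discrete, and there exists a $\rho$-confining subset $Q\subseteq H$ that is a subgroup and such that $X$ is $G$-equivariantly quasi-isometric to $\mathrm{Cay}(G,Q\cup Z_\rho)$, where $Q=H$ if the action is oriented lineal and $Q$ is strictly $\rho$-confining if the action is quasi-parabolic.
   Context: Trees are simplicial trees, with the path metric. Semidirect products are internal, and $x^y=y^{-1}xy$. A character is a homomorphism to $\mathbb{R}$; it is discrete if its image is cyclic. For an isometric action of $G$ on a hyperbolic space with limit set $\Lambda(G)\subseteq\partial X$: the action is oriented lineal if $|\Lambda(G)|=2$ and both limit points are fixed; it is quasi-parabolic if $|\Lambda(G)|=\infty$ and $G$ fixes a (unique) point of $\partial X$. It is cobounded if translates of some bounded set cover $X$. If $G$ fixes $\xi\in\partial X$, choose $x_i\to\xi$ and $x\in X$; then $q(g)=\limsup_i(d(x,x_i)-d(gx,x_i))$ is a quasimorphism, and the Busemann pseudocharacter is its homogenization $p(g)=\lim_m q(g^m)/m$ (independent of choices). In the oriented lineal case the two fixed points give $p$ and $-p$, and either sign may be chosen. A subset $Q\subseteq H$ is $\rho$-confining if $Q=Q^{-1}$ and: $Q^z\subseteq Q$ for all $z\in\mathbb{Z}^n$ with $\rho(z)\ge0$; for every $h\in H$ there is $z\in\mathbb{Z}^n$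 with $h^z\in Q$; and there is $z_0\in\mathbb{Z}^n$ with $(Q\cdot Q)^{z_0}\subseteq Q$. It is strictly $\rho$-confining if moreover $Q^z\subsetneq Q$ for some $z\in\mathbb{Z}^n$. Fix a finite generating set $\{a_1,\dots,a_n\}$ of $\mathbb{Z}^n$ and a constant $C_\rho>0$ with $|\rho(a_i)|\le C_\rho$ for all $i$ and such that $C_\rho=\rho(z_{top})$ for some $z_{top}\in\mathbb{Z}^n$; set $Z_\rho=\{z\in\mathbb{Z}^n:|\rho(z)|\le C_\rho\}$. For $\rho$-confining $Q$, $Q\cup Z_\rho$ generates $G$. ''$X$ is $G$-equivariantly quasi-isometric to $\mathrm{Cay}(G,A)$'' means that there is a $G$-equivariant quasi-isometry to $X$ from the vertex set $G$ of $\mathrm{Cay}(G,A)$ with the word metric. *)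

(* Defs.v *)
From mathcomp Require Import all_boot all_order all_algebra.
From mathcomp Require Import all_classical all_reals all_analysis.

Set Implicit Arguments.
Unset Strict Implicit.
Unset Printing Implicit Defensive.

Import Order.TTheory GRing.Theory Num.Theory.
Import numFieldNormedType.Exports.

Local Open Scope classical_set_scope.
Local Open Scope ring_scope.

Section Graphs.
Context {R : realType}.

(* The infimum is attained whenever x and y are joined by a path; otherwise
   the value is the junk value 0. *)
Definition path_metric (V : eqType) (E : rel V) (x y : V) : R :=
  inf [set r | exists p : seq V,
    [/\ path E x p, last x p = y & r = (size p)%:R]].

Definition graph_connected (V : eqType) (E : rel V) : Prop :=
  forall x y : V, exists2 p : seq V, path E x p & last x p = y.

(* A simplicial tree, given by its vertex set V (metrized by [path_metric]) and
   its adjacency relation. The back and forth traversal of one edge is a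
   [ucycle] of size 2, hence the bound. *)
Definition is_tree (V : eqType) (E : rel V) : Prop :=
  [/\ inhabited V, symmetric E, irreflexive E, graph_connected E &
      forall c : seq V, ucycle E c -> (size c <= 2)%N].

(* The Cayley graph on which G acts by left multiplication: edges g -- g a. *)
Definition cayley_adj (G : groupType) (A : set G) : rel G :=
  fun g h => `[< A (g^-1 * h)%g \/ A (h^-1 * g)%g >].

Definition word_metric (G : groupType) (A : set G) : G -> G -> R :=
  path_metric (cayley_adj A).

End Graphs.

Definition is_action (G : groupType) (X : Type) (act : G -> X -> X) : Prop :=
  (forall x, act 1%g x = x) /\
  (forall g h x, act (g * h)%g x = act g (act h x)).

Definition simplicial_action (G : groupType) (V : eqType) (E : rel V)
    (act : G -> V -> V) : Prop :=
  is_action act /\ (forall g x y, E (act g x) (act g y) = E x y).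

Section IsometricActions.
Context {R : realType} {X : Type} (d : X -> X -> R).

Definition cobounded (G : groupType) (act : G -> X -> X) : Prop :=
  exists B : set X,
    (exists r, forall x y, B x -> B y -> d x y <= r) /\
    \bigcup_(g in [set: G]) (act g @` B) = [set: X].

Definition gromov_product (o x y : X) : R := (d o x + d o y - d x y) / 2.

(* (s_i | t_j)_o tends to infinity with min(i, j), for every base point o. *)
Definition gromov_divergent (s t : nat -> X) : Prop :=
  forall (o : X) (M : R), exists N : nat, forall i j,
    (N <= i)%N -> (N <= j)%N -> M <= gromov_product o (s i) (t j).

Definition converges_at_infinity (s : nat -> X) : Prop := gromov_divergent s s.

(* A boundary point of a hyperbolic space is the set of all the sequences that
   converge to it; thus [xi s] reads "s converges to xi". *)
Definition boundary_class (s : nat -> X) : set (nat -> X) :=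
  [set t | converges_at_infinity t /\ gromov_divergent s t].

Definition gromov_boundary : set (set (nat -> X)) :=
  [set xi | exists2 s, converges_at_infinity s & xi = boundary_class s].

Context {G : groupType} (act : G -> X -> X).

Definition boundary_act (g : G) (xi : set (nat -> X)) : set (nat -> X) :=
  [set (fun i => act g (s i)) | s in xi].

Definition fixes_boundary_point (xi : set (nat -> X)) : Prop :=
  forall g : G, boundary_act g xi = xi.

Definition limit_set : set (set (nat -> X)) :=
  [set xi | gromov_boundary xi /\
            exists (x : X) (g : nat -> G), xi (fun i => act (g i) x)].

Definition oriented_lineal : Prop :=
  (limit_set #= `I_2)%card /\
  (forall xi, limit_set xi -> fixes_boundary_point xi).

Definition quasi_parabolic : Prop :=
  infinite_set limit_set /\
  (exists! xi, gromov_boundary xi /\ fixes_boundary_point xi).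

(* s is a sequence converging to the fixed boundary point, x a base point. *)
Definition busemann_quasimorphism (s : nat -> X) (x : X) (g : G) : R :=
  limn_sup (fun i => d x (s i) - d (act g x) (s i)).

Definition busemann_pseudocharacter (s : nat -> X) (x : X) (g : G) : R :=
  limn (fun m : nat => busemann_quasimorphism s x (g ^+ m)%g / m%:R).

(* A G-equivariant quasi-isometry from the vertex set of Cay(G, A) to X. *)
Definition equivariantly_qi_to_cayley (A : set G) : Prop :=
  graph_connected (cayley_adj A) /\
  exists f : G -> X,
    (forall g h, f (g * h)%g = act g (f h)) /\
    exists L K : R,
      [/\ 0 < L, 0 <= K,
          forall g h, L^-1 * word_metric A g h - K <= d (f g) (f h)
                      <= L * word_metric A g h + K &
          forall x, exists g, d (f g) x <= K].

End IsometricActions.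

Definition is_subgroup (G : groupType) (S : set G) : Prop :=
  S 1%g /\ (forall x y, S x -> S y -> S (x * y^-1)%g).

(* G is the internal semidirect product of H and of a copy of Z^n, embedded by
   the group isomorphism iota onto its image. *)
Definition semidirect_Zn (G : groupType) (H : set G) (n : nat)
    (iota : 'rV[int]_n -> G) : Prop :=
  [/\ is_subgroup H /\ (forall h g, H h -> H (h ^ g)%g),
      forall u v, iota (u + v) = (iota u * iota v)%g,
      injective iota,
      H `&` range iota = [set 1%g] &
      forall g, exists h z, H h /\ g = (h * iota z)%g].

(* The set Q^z of conjugates x^z = z^-1 x z of the elements of Q. *)
Definition conj_set (G : groupType) (Q : set G) (z : G) : set G :=
  [set (x ^ z)%g | x in Q].

Section Confining.
Context {R : realType} {G : groupType} (H : set G) {n : nat}.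
Context (iota : 'rV[int]_n -> G) (rho : 'rV[int]_n -> R).

Definition confining (Q : set G) : Prop :=
  [/\ Q `<=` H,
      Q = [set (x^-1)%g | x in Q],
      forall z, 0 <= rho z -> conj_set Q (iota z) `<=` Q,
      forall h, H h -> exists z, Q (h ^ iota z)%g &
      exists z0, conj_set [set (x * y)%g | x in Q & y in Q] (iota z0) `<=` Q].

Definition strictly_confining (Q : set G) : Prop :=
  confining Q /\ exists z, conj_set Q (iota z) `<` Q.

Definition generates_Zn (a : 'I_n -> 'rV[int]_n) : Prop :=
  forall z, exists c : 'I_n -> int, z = \sum_i a i *~ c i.

Definition admissible_constant (a : 'I_n -> 'rV[int]_n) (C : R) : Prop :=
  [/\ 0 < C, forall i, `|rho (a i)| <= C & exists ztop, C = rho ztop].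

(* Z_rho, as a subset of G. *)
Definition Z_rho (C : R) : set G := [set iota z | z in [set z | `|rho z| <= C]].

Definition discrete_character : Prop :=
  exists c : R, range rho = range (fun k : int => c *~ k).

End Confining.

(* Main.v *)
From HB Require Import structures.
Require Import Defs.
From mathcomp Require Import all_boot all_order all_algebra.
From mathcomp Require Import all_classical all_reals all_analysis.
From mathcomp Require Import zify lra.

Set Implicit Arguments.
Unset Strict Implicit.
Unset Printing Implicit Defensive.

Import Order.TTheory GRing.Theory Num.Theory.
Import numFieldNormedType.Exports.

Local Open Scope classical_set_scope.
Local Open Scope ring_scope.

(** A boundary point xi of a tree orients it: every vertex v has a unique
    neighbour [par v] on the ray from v to xi ([exists_parent]), every edge
    joins a vertex to its parent ([parent_towards_or_from]), and the Busemann
    function b of xi, which rises by one from v to [par v], takes integer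
    values ([exists_level]). Since G fixes xi, it commutes with [par] and
    shifts all heights by the same amount, so the Busemann quasimorphism is
    already a homomorphism to the integers, equal to its homogenization. Hence
    rho is discrete. It is not zero, for otherwise a cobounded action would
    bound the heights, which are unbounded along a ray to xi
    ([cobounded_translation]).

    Let t in Z^n climb, that is rho t > 0. Every ray to xi contains vertices
    that t moves along this ray. Let x0 be one of them. As Z^n is commutative,
    all of Z^n moves x0 along one line, the axis of t ([commuting_on_axis]).
    Take for Q the stabilizer of x0 in H. What fixes a vertex fixes all its
    ancestors, so conjugation by climbing elements maps Q into itself; and h
    in H preserves heights, so it fixes the common ancestors of x0 and h x0,
    which gives the absorption property ([stab_confining]).

    The orbit map of x0 is Lipschitz because the generators move x0 by a
    bounded amount. Conversely let g = h z move x0 by m. The rays from x0 and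
    g x0 meet after at most m steps, h fixes the axis from a height
    proportional to m on, so h is the conjugate of an element of Q by a power
    of ztop that is linear in m, and z is a product of at most m + 1 elements
    of Z_rho ([displacement_walk]).

    Finally consider the other end eta of the axis, the limit of t^-i x0. An
    element h of H that fixes eta must fix x0 ([fixed_repelling_stab]); in the
    lineal case eta is a limit point, hence fixed, and Q = H. If Q is not
    strictly confining, then Q = H fixes the whole orbit of x0 under Z^n, so G
    fixes eta ([stab_fixed_repelling]); but eta differs from xi, which
    contradicts the uniqueness of the fixed point in the quasi-parabolic case. *)

(** * Distances in connected graphs *)

Section Walks.
Context {V : eqType}.
Implicit Types (E : rel V) (x y z : V).

(** Walks by recursion on their length, as the arguments below peel off the
    first step; the paths of the library keep their vertices in a sequence. *)
Fixpoint walk E (n : nat) x y : Prop :=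
  if n is m.+1 then exists2 z, E x z & walk E m z y else x = y.

Lemma walkP E n x y :
  walk E n x y <-> exists p, [/\ path E x p, last x p = y & size p = n].
Proof.
elim: n x => [|n IHn] x /=; split.
- by move=> <-; exists [::].
- by move=> [[|? ?] [_ <- //]].
- by move=> [z xz /IHn[p [pp lp sp]]]; exists (z :: p); rewrite /= xz pp lp sp.
- move=> [[[] //|z p] /= [/andP[xz pp] lp [sp]]].
  by exists z => //; apply/IHn; exists p.
Qed.

Lemma walk1 E x y : E x y -> walk E 1 x y.
Proof. by exists y. Qed.

Lemma walk_cat E m n x y z :
  walk E m x y -> walk E n y z -> walk E (m + n) x z.
Proof.
elim: m x => [x -> //|m IHm x [w xw wy] yz]; rewrite addSn.
by exists w => //; exact: IHm.
Qed.

Lemma walk_sym E n x y : symmetric E -> walk E n x y -> walk E n y x.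
Proof.
move=> sE; elim: n x => [x -> //|n IHn x [w xw /IHn wy]].
by rewrite -addn1; apply: walk_cat wy _; apply: walk1; rewrite sE.
Qed.

Lemma walk_map E n x y (f : V -> V) :
  (forall u v, E u v -> E (f u) (f v)) -> walk E n x y -> walk E n (f x) (f y).
Proof.
move=> fE; elim: n x => [x -> //|n IHn x [w xw wy]].
by exists (f w); [exact: fE|exact: IHn].
Qed.

End Walks.

Section GraphDistance.
Context {V : eqType} {E : rel V} (hE : graph_connected E).
Implicit Types x y z : V.

Lemma exists_walk x y : exists n, `[< walk E n x y >].
Proof.
have [p pp lp] := hE x y; exists (size p).
by apply/asboolP/walkP; exists p.
Qed.

(** The length of a shortest path: a natural number, so that one can argue by
    induction on distances. *)
Definition gdist x y : nat := ex_minn (exists_walk x y).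

Lemma gdist_walk x y : walk E (gdist x y) x y.
Proof. by rewrite /gdist; case: ex_minnP => m /asboolP. Qed.

Lemma gdist_le n x y : walk E n x y -> (gdist x y <= n)%N.
Proof.
by move=> w; rewrite /gdist; case: ex_minnP => m _; apply; exact/asboolP.
Qed.

(** The infimum defining the metric is attained by a shortest path. *)
Lemma path_metricE (R : realType) x y : path_metric E x y = (gdist x y)%:R :> R.
Proof.
rewrite /path_metric; set A := [set r | _].
have A_gdist : A (gdist x y)%:R.
  by have /walkP[p [pp lp sp]] := gdist_walk x y; exists p; rewrite sp.
have lbA : lbound A (gdist x y)%:R.
  by move=> _ [p [pp lp ->]]; rewrite ler_nat; apply/gdist_le/walkP; exists p.
apply/eqP; rewrite eq_le; apply/andP; split.
  by apply: ge_inf => //; exists (gdist x y)%:R.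
by apply: lb_le_inf => //; exists (gdist x y)%:R.
Qed.

Lemma gdistxx x : gdist x x = 0%N.
Proof. by apply/eqP; rewrite -leqn0; apply: gdist_le. Qed.

Lemma gdist_eq0 x y : gdist x y = 0%N -> x = y.
Proof. by move=> xy0; have := gdist_walk x y; rewrite xy0. Qed.

Lemma gdist_triangle y x z : (gdist x z <= gdist x y + gdist y z)%N.
Proof. by apply: gdist_le; apply: walk_cat; exact: gdist_walk. Qed.

Context (sE : symmetric E).

Lemma gdistC x y : gdist x y = gdist y x.
Proof.
apply/eqP; rewrite eqn_leq.
by apply/andP; split; apply/gdist_le/(walk_sym sE)/gdist_walk.
Qed.

Lemma gdist_isometry (f : V -> V) (f' : V -> V) :
  (forall u v, E u v -> E (f u) (f v)) ->
  (forall u v, E u v -> E (f' u) (f' v)) -> cancel f f' ->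
  forall x y, gdist (f x) (f y) = gdist x y.
Proof.
move=> fE f'E fK x y; apply/eqP; rewrite eqn_leq; apply/andP; split.
  by apply/gdist_le/walk_map/gdist_walk.
by rewrite -{1}(fK x) -{1}(fK y); apply/gdist_le/walk_map/gdist_walk.
Qed.

End GraphDistance.

(** * Geodesics in trees *)

Section Trees.
Context {V : eqType} {E : rel V} (hT : is_tree E) (hE : graph_connected E).
Implicit Types a b u v w x y : V.
Local Notation dist := (gdist hE).

Let sE : symmetric E. Proof. by case: hT. Qed.
Let iE : irreflexive E. Proof. by case: hT. Qed.

(** Deleting v from a tree separates its neighbours: a path between two of them
    would close up to a cycle through v. *)
Lemma tree_separation n v w1 w2 :
  walk [rel a b | [&& E a b, a != v & b != v]] n w1 w2 ->
  E v w1 -> E v w2 -> w1 = w2.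
Proof.
move=> /walkP[p [pp lp _]] vw1 vw2.
have pv q w : path [rel a b | [&& E a b, a != v & b != v]] w q ->
    w != v -> path E w q && (v \notin w :: q).
  elim: q w => [|c q IHq] w /=; first by rewrite inE eq_sym => _ /negbTE->.
  move=> /andP[/and3P[wc _ cv] /IHq/(_ cv)/andP[-> nv]] wv.
  by rewrite wc inE negb_or eq_sym wv.
have w1v : w1 != v by apply/eqP => e; move: vw1; rewrite e iE.
case/shortenP: pp lp => p' pp' up' _ lp'.
have /andP[Epp' nv] := pv _ _ pp' w1v.
have [_ _ _ _ /(_ (v :: w1 :: p'))] := hT.
rewrite /ucycle /= in nv up' *.
rewrite nv up' rcons_path vw1 Epp' lp' sE vw2 => /(_ isT).
by case: p' {pp' up' Epp' nv} lp'.
Qed.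

(** A walk from w to y through v is longer than the distance from v to y. *)
Lemma short_walk_avoids n v w y :
  walk E n w y -> (n <= dist v y)%N -> w != v ->
  walk [rel a b | [&& E a b, a != v & b != v]] n w y.
Proof.
elim: n w => [//|n IHn] w [c wc cy] nv wv.
have cv : c != v.
  by apply/eqP => cv; have := gdist_le hE cy; rewrite cv leqNgt nv.
by exists c; [rewrite /= wc wv cv|apply: IHn => //; exact: ltnW].
Qed.

(** Geodesics to y from two such neighbours both avoid v, so together they
    would join the two neighbours away from v. *)
Lemma tree_closer_unique v w1 w2 y : E v w1 -> E v w2 ->
  (dist w1 y <= dist v y)%N -> (dist w2 y <= dist v y)%N -> w1 = w2.
Proof.
have nv w : E v w -> w != v.
  by move=> vw; apply/eqP => e; move: vw; rewrite e iE.
move=> vw1 vw2 d1 d2; apply: (tree_separation _ vw1 vw2); apply: walk_cat.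
  by apply: short_walk_avoids (gdist_walk hE w1 y) d1 (nv _ vw1).
apply: walk_sym; first by move=> a b /=; rewrite sE [(a != v) && _]andbC.
by apply: short_walk_avoids (gdist_walk hE w2 y) d2 (nv _ vw2).
Qed.

Definition closer y v w := E v w /\ dist v y = (dist w y).+1.

Lemma exists_closer v y : v <> y -> exists w, closer y v w.
Proof.
move=> vy; have := gdist_walk hE v y; case e : (dist v y) => [//|n] [w vw wy].
exists w; split => //; rewrite e; congr S; apply/eqP.
rewrite eqn_leq (gdist_le hE wy) andbT -ltnS -e -add1n.
apply: leq_trans (gdist_triangle hE w _ _) _.
by rewrite leq_add2r; apply/gdist_le/walk1.
Qed.

(** Distances to y differ along every edge: at equality, w would be a second
    neighbour of v that is no farther from y than v. *)
Lemma closer_dichotomy v w y : E v w -> closer y v w \/ closer y w v.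
Proof.
move=> vw; have wv : E w v by rewrite sE.
have d1 : (dist v y <= (dist w y).+1)%N.
  rewrite -add1n; apply: leq_trans (gdist_triangle hE w _ _) _.
  by rewrite leq_add2r; apply/gdist_le/walk1.
have d2 : (dist w y <= (dist v y).+1)%N.
  rewrite -add1n; apply: leq_trans (gdist_triangle hE v _ _) _.
  by rewrite leq_add2r; apply/gdist_le/walk1.
have [e|ne] := eqVneq (dist v y) (dist w y).
  have vy : v <> y.
    move=> vy; move: e; rewrite vy gdistxx => /esym /gdist_eq0 wy.
    by move: vw; rewrite vy wy iE.
  have [u [vu du]] := exists_closer vy.
  suff uw : u = w by move: e; rewrite du uw => /eqP; rewrite eqn_leq ltnn.
  by apply: (tree_closer_unique vu vw (y := y)); rewrite ?e // -e du.
case: (ltnP (dist w y) (dist v y)) => h; [left|right]; split => //; lia.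
Qed.

(** If the step from u towards a moves away from b, then u separates a
    from b. *)
Lemma tree_dist_between a b u w :
  closer a u w -> closer b w u -> dist a b = (dist a u + dist u b)%N.
Proof.
rewrite (gdistC hE sE a u).
elim: {u}(dist u a) {-2}u w (erefl (dist u a)) => [|n IHn] u w e
    [uw du] [wu dw].
  by rewrite e in du.
rewrite e in du; have {}du : dist w a = n by case: du.
have [wa|/eqP/exists_closer wa] := eqVneq w a.
  by rewrite e -du wa gdistxx -wa dw add1n.
have [w' [ww' dw']] := wa.
have [cl|cl] := closer_dichotomy b ww'.
  have w'u : w' = u.
    by apply: (tree_closer_unique ww' wu (y := b)); case: cl => _; lia.
  by move: dw'; rewrite w'u e; lia.
by rewrite (IHn w w' du (conj ww' dw') cl) dw; lia.
Qed.

(** If the geodesics from v to a and to b leave v along different edges, then v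
    lies between a and b and their Gromov product at v vanishes. *)
Lemma gromov_closer (R : realType) (d : V -> V -> R) a b v w :
  d = path_metric E -> 1 <= gromov_product d v a b ->
  closer a v w -> closer b v w.
Proof.
move=> hd; rewrite /gromov_product hd !(path_metricE hE) => g1 cl.
have [//|cl'] := closer_dichotomy b cl.1.
move: g1; rewrite (tree_dist_between cl cl') (gdistC hE sE a v) natrD.
by rewrite subrr mul0r ler10.
Qed.

End Trees.

(** * The orientation of a tree towards a boundary point *)

Section BoundaryPointOfTree.
Context {R : realType} {V : choiceType} {E : rel V}.
Context (hT : is_tree E) (hE : graph_connected E).
Context (d : V -> V -> R) (hd : d = path_metric E).
Context (xi : set (nat -> V)) (hxi : gromov_boundary d xi).
Implicit Types u v w x y : V.
Local Notation dist := (gdist hE).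

(** [par v] is the neighbour of v on the ray from v to xi, as seen by every
    sequence that converges to xi. *)
Definition parent_towards (par : V -> V) := forall v s, xi s ->
  exists N, forall i, (N <= i)%N -> closer hE (s i) v (par v).

(** Two sequences converging to xi eventually have Gromov product at least one
    at v, hence leave v along the same edge. *)
Lemma exists_parent : exists par, parent_towards par.
Proof.
suff /choice[par hpar] : forall v, exists w, forall s, xi s ->
    exists N, forall i, (N <= i)%N -> closer hE (s i) v w by exists par.
move=> v.
have [s0 s0cv xiE] := hxi.
have [N0 hN0] := s0cv v 1.
have vs0 : v <> s0 N0.
  move=> vs; have := hN0 N0 N0 (leqnn _) (leqnn _).
  rewrite -vs /gromov_product hd !(path_metricE hE) gdistxx subr0 addr0.
  by rewrite mul0r ler10.
have [w cl] := exists_closer hE vs0.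
exists w => s; rewrite xiE => -[scv /(_ v 1)[N1 hN1]]; exists N1 => i Ni.
have := hN1 (maxn N0 N1) i (leq_maxr _ _) Ni; move/(gromov_closer hT hd); apply.
apply: (gromov_closer hT hd _ cl); apply: hN0 => //; exact: leq_maxl.
Qed.

Context (par : V -> V) (hpar : parent_towards par).
Context (s : nat -> V) (hs : xi s).

Lemma adj_parent_towards v : E v (par v).
Proof. by have [N /(_ N (leqnn N))[]] := hpar v hs. Qed.

Lemma parent_towards_or_from v w : E v w -> w = par v \/ v = par w.
Proof.
move=> vw; have [N1 h1] := hpar v hs; have [N2 h2] := hpar w hs.
have [] := h1 (maxn N1 N2) (leq_maxl _ _).
have [] := h2 (maxn N1 N2) (leq_maxr _ _).
set y := s _ => wp d2 vp d1.
have [_ sE _ _ _] := hT; have wv : E w v by rewrite sE.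
have [[_ d3]|[_ d3]] := closer_dichotomy hT hE y vw; [left|right].
  by apply: (tree_closer_unique hT vw vp (y := y)); lia.
by apply: (tree_closer_unique hT wv wp (y := y)); lia.
Qed.

(** An isometry fixing xi carries rays to xi to rays to xi. *)
Lemma parent_equivariant (f : V -> V) v :
  (forall x y, dist (f x) (f y) = dist x y) ->
  (forall x y, E (f x) (f y) = E x y) ->
  xi (f \o s) -> par (f v) = f (par v).
Proof.
move=> fdist fE fs; have [N1 h1] := hpar v hs; have [N2 h2] := hpar (f v) fs.
have [] := h1 (maxn N1 N2) (leq_maxl _ _).
have [] := h2 (maxn N1 N2) (leq_maxr _ _) => /=.
move=> e2 d2 e1 d1; have e3 : E (f v) (f (par v)) by rewrite fE.
apply: (tree_closer_unique hT e2 e3 (y := f (s (maxn N1 N2)))); first by lia.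
by rewrite !fdist; lia.
Qed.

(** The Busemann function of s normalized at x, with the sign that makes it
    grow towards the end. *)
Definition level_along (x : V) (b : V -> int) := forall v,
  exists N, forall i, (N <= i)%N -> (dist x (s i))%:Z - (dist v (s i))%:Z = b v.

(** Along an edge the distance to the i-th term of s changes by exactly one,
    in a direction independent of large i; sum over a walk from v to x. *)
Lemma exists_level x : exists b, level_along x b.
Proof.
suff /choice[b hb] : forall v, exists z, exists N, forall i, (N <= i)%N ->
    (dist x (s i))%:Z - (dist v (s i))%:Z = z by exists b.
move=> v.
move: (dist v x) (gdist_walk hE v x) => n.
elim: n v => [u ->|n IHn u [w uw]].
  by exists 0, 0%N => i _; rewrite subrr.
move=> /IHn[z [N hN]]; have [wu|uw'] := parent_towards_or_from uw.
  have [N' hN'] := hpar u hs; exists (z - 1), (maxn N N') => i.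
  rewrite geq_max => /andP[/hN hi /hN'[_ hi']].
  by rewrite hi' -wu; lia.
have [N' hN'] := hpar w hs; exists (z + 1), (maxn N N') => i.
rewrite geq_max => /andP[/hN hi /hN'[_ hi']].
by move: hi; rewrite hi' -uw'; lia.
Qed.

Lemma level_parent x b v : level_along x b -> b (par v) = b v + 1.
Proof.
move=> hb; have [N1 h1] := hb v; have [N2 h2] := hb (par v).
have [N3 h3] := hpar v hs; pose N := maxn N1 (maxn N2 N3).
have := h1 N (leq_maxl _ _); have := h2 N; have := h3 N.
rewrite /N !leq_max !leqnn !orbT => /(_ isT)[_ ->] /(_ isT) <- <-; lia.
Qed.

Lemma level_base x b : level_along x b -> b x = 0.
Proof. by move=> /(_ x)[N /(_ N (leqnn N))]; rewrite subrr. Qed.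

Lemma busemann_quasimorphism_level (G : groupType) (act : G -> V -> V) x b g :
  level_along x b -> busemann_quasimorphism d act s x g = (b (act g x))%:~R.
Proof.
move=> /(_ (act g x))[N hN].
apply: (cvg_limn_inf_sup _).2; apply: cvg_near_cst; exists N => // i /= Ni.
by rewrite hd !(path_metricE hE) -(hN i Ni) intrB -!pmulrn.
Qed.

End BoundaryPointOfTree.

(** A quasimorphism that is linear on powers is its own homogenization. *)
Lemma busemann_pseudocharacter_hom (R : realType) (X : Type) (d : X -> X -> R)
    (G : groupType) (act : G -> X -> X) s x g :
  (forall m, busemann_quasimorphism d act s x (g ^+ m)%g =
             m%:R * busemann_quasimorphism d act s x g) ->
  busemann_pseudocharacter d act s x g = busemann_quasimorphism d act s x g.
Proof.
move=> qX; apply: lim_near_cst => //; exists 1%N => // m /= m_gt0.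
by rewrite qX mulrAC mulfV ?mul1r// pnatr_eq0 -lt0n.
Qed.

(** * Heights and distances in a graph oriented to an end *)

(** What remains of a tree with a chosen end: all metric facts below follow
    from the parent map and the height b, without returning to cycles. *)
Record oriented_to_end (V : eqType) (E : rel V) (par : V -> V) (b : V -> int) :
  Prop := OrientedToEnd {
  par_adj : forall v, E v (par v);
  adj_par : forall v w, E v w -> w = par v \/ v = par w;
  level_par : forall v, b (par v) = b v + 1 }.

Section OrientedGraph.
Context {V : eqType} {E : rel V} (hE : graph_connected E).
Context {par : V -> V} {b : V -> int} (ho : oriented_to_end E par b).
Implicit Types u v w : V.
Local Notation dist := (gdist hE).

Lemma level_iter k v : b (iter k par v) = b v + k%:Z.
Proof.
by elim: k => [|k IHk]; rewrite ?addr0//= (level_par ho) IHk -addn1 PoszD addrA.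
Qed.

(** Along a walk the two ancestor lines of its ends meet early: each step
    either climbs, or undoes the first climb of the rest of the walk. *)
Lemma walk_merge n u v : walk E n u v ->
  exists k l, (k + l <= n)%N /\ iter k par u = iter l par v.
Proof.
elim: n u => [u ->|n IHn u [w uw /IHn[k [l [kl e]]]]]; first by exists 0%N, 0%N.
have [wu|uw'] := adj_par ho uw.
  by exists k.+1, l; rewrite addSn ltnS kl iterSr -wu.
case: k kl e => [|k] kl e.
  by exists 0%N, l.+1; rewrite /= -e.
by exists k, l; split; [lia|rewrite uw' -iterSr].
Qed.

(** Once k exceeds the distance, both sides lie above the place where the
    ancestor lines of u and v meet, at the same height. *)
Lemma level_merge u v m n k : b u + m%:Z = b v + n%:Z -> (dist u v <= k)%N ->
  iter (k + m) par u = iter (k + n) par v.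
Proof.
move=> e uvk; have [i [j [ij eij]]] := walk_merge (gdist_walk hE u v).
have /(congr1 b) := eij; rewrite !level_iter => e'.
have -> : (k + m = k + m - i + i)%N by lia.
have -> : (k + n = k + m - i + j)%N by lia.
by rewrite !iterD eij.
Qed.

(** Each edge changes the height by one, so climbing is geodesic. *)
Lemma dist_iter m v : dist v (iter m par v) = m.
Proof.
apply/eqP; rewrite eqn_leq; apply/andP; split.
  apply: gdist_le; elim: m v => [//|m IHm] v; exists (par v).
    exact: par_adj ho v.
  by rewrite iterSr.
have [i [j [ij /(congr1 b)]]] := walk_merge (gdist_walk hE v (iter m par v)).
by rewrite !level_iter; lia.
Qed.

Lemma level_lipschitz u v : `|b u - b v| <= (dist u v)%:Z.
Proof.
have [i [j [ij /(congr1 b)]]] := walk_merge (gdist_walk hE u v).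
by rewrite !level_iter; lia.
Qed.

End OrientedGraph.

(** * Actions, semidirect products and integer-valued characters *)

Section Actions.
Context {G : groupType} {X : Type} {act : G -> X -> X} (ha : is_action act).

Lemma actK g : cancel (act g) (act g^-1%g).
Proof. by case: ha => a1 aM x; rewrite -aM mulVg a1. Qed.

Lemma actKV g : cancel (act g^-1%g) (act g).
Proof. by case: ha => a1 aM x; rewrite -aM mulgV a1. Qed.

Lemma act_commute g h x :
  (g * h = h * g)%g -> act g (act h x) = act h (act g x).
Proof. by case: ha => _ aM gh; rewrite -!aM gh. Qed.

End Actions.

Lemma act_gdist (G : groupType) (V : eqType) (E : rel V)
    (hE : graph_connected E) (act : G -> V -> V) g x y :
  simplicial_action E act ->
  gdist hE (act g x) (act g y) = gdist hE x y.
Proof.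
move=> [ha aE]; apply: gdist_isometry (actK ha g) _ _ => u v;
  by rewrite aE.
Qed.

Section SemidirectZn.
Context {G : groupType} {H : set G} {n : nat} {iota : 'rV[int]_n -> G}.
Context (hG : semidirect_Zn H iota).
Implicit Types z : 'rV[int]_n.

Lemma factor_subgroup : is_subgroup H. Proof. by case: hG => -[]. Qed.

Lemma factor_normal h g : H h -> H (h ^ g)%g.
Proof. by case: hG => -[_ HJ] _ _ _ _; exact: HJ. Qed.

Lemma semidirect_decomposition g : exists h z, H h /\ g = (h * iota z)%g.
Proof. by case: hG. Qed.

Lemma embeddingD u v : iota (u + v) = (iota u * iota v)%g.
Proof. by case: hG. Qed.

Lemma embedding0 : iota 0 = 1%g.
Proof. by apply: (@mulgI _ (iota 0)); rewrite -embeddingD addr0 mulg1. Qed.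

Lemma embeddingN z : iota (- z) = ((iota z)^-1)%g.
Proof.
by apply: (@mulgI _ (iota z)); rewrite -embeddingD subrr embedding0 mulgV.
Qed.

Lemma embeddingX z k : iota (z *+ k) = (iota z ^+ k)%g.
Proof.
by elim: k => [|k IHk]; rewrite ?embedding0// mulrS embeddingD IHk expgS.
Qed.

Lemma embeddingC u v : (iota u * iota v = iota v * iota u)%g.
Proof. by rewrite -!embeddingD addrC. Qed.

End SemidirectZn.

(** The image of an additive map to the integers is generated by its least
    positive value. *)
Lemma int_range_cyclic (U : zmodType) (f : U -> int) :
  zmod_morphism f -> (exists u, f u != 0) ->
  exists c : int, range f = range (fun k : int => c *~ k).
Proof.
move=> fB [u fu].
pose F : {additive U -> int} :=
  HB.pack f (GRing.isZmodMorphism.Build U int f fB).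
have : exists k, `[< (0 < k)%N /\ exists u, F u = k%:Z >].
  exists `|f u|%N; apply/asboolP; split; first by rewrite absz_gt0.
  have [fu0|fu0] := lerP 0 (f u); first by exists u; rewrite gez0_abs.
  by exists (- u); rewrite raddfN/= ltz0_abs.
move=> /ex_minnP[c /asboolP[c_gt0 [w Fw]] cmin].
exists c%:Z; apply/seteqP; split=> [_ [v _ <-]|_ [k _ <-]] /=; last first.
  by exists (w *~ k) => //; rewrite -[f _]/(F _) raddfMz Fw.
exists (f v %/ c)%Z => //; rewrite -mulrzr mulrC.
have c0 : c%:Z != 0 by rewrite eqz_nat -lt0n.
rewrite [RHS](divz_eq _ c) -[LHS]addr0; congr (_ + _); first by rewrite intz.
apply/eqP; rewrite eq_sym; apply: contraT => r0.
have Fr : F (v - w *~ (f v %/ c)%Z) = (f v %% c)%Z.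
  rewrite raddfB raddfMz Fw /= {1}(divz_eq (f v) c) -mulrzr intz mulrC.
  by rewrite addrAC subrr add0r.
have rge : 0 <= (f v %% c)%Z by exact: modz_ge0.
have rlt : (f v %% c)%Z < c%:Z by exact: ltz_pmod.
suff : (c <= `|(f v %% c)%Z|)%N by lia.
apply: cmin; apply/asboolP; split; first by rewrite absz_gt0.
by exists (v - w *~ (f v %/ c)%Z); rewrite Fr gez0_abs.
Qed.

(** * Actions preserving an end *)

(** The displacement of heights by an action that preserves the end: with b a
    Busemann function, this is the Busemann pseudocharacter. *)
Definition translation_character (V : Type) (b : V -> int) (G : groupType)
    (act : G -> V -> V) (pz : G -> int) :=
  forall g v, b (act g v) = b v + pz g.

Section OrientedAction.
Context {V : eqType} {E : rel V} (hE : graph_connected E).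
Context {par : V -> V} {b : V -> int} (ho : oriented_to_end E par b).
Context {G : groupType} {act : G -> V -> V} (hact : simplicial_action E act).
Context (parJ : forall g v, par (act g v) = act g (par v)).
Implicit Types u v w : V.
Local Notation dist := (gdist hE).

Let ha : is_action act. Proof. by case: hact. Qed.

Lemma iter_parJ k g v : iter k par (act g v) = act g (iter k par v).
Proof. by elim: k => //= k ->; rewrite parJ. Qed.

(** Any two vertices have a common ancestor, and the numbers of steps up to it
    are preserved by g. *)
Lemma level_act g u v : b (act g u) - b u = b (act g v) - b v.
Proof.
have [k [l [_ e]]] := walk_merge ho (gdist_walk hE u v).
have /(congr1 b) := e; have /(congr1 (b \o act g)) := e.
by rewrite /= -!iter_parJ !(level_iter ho); lia.
Qed.

Lemma exists_translation_character v0 :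
  translation_character b act (fun g => b (act g v0) - b v0).
Proof. by move=> g v; rewrite -(level_act g v v0) addrC subrK. Qed.

Context {pz : G -> int} (hpz : translation_character b act pz) (v0 : V).

Lemma translationM g h : pz (g * h)%g = pz g + pz h.
Proof.
have := hpz (g * h)%g v0; rewrite ha.2 !hpz -addrA => /addrI <-.
by rewrite addrC.
Qed.

Lemma translation1 : pz 1%g = 0.
Proof. by have := translationM 1%g 1%g; rewrite mulg1; lia. Qed.

Lemma translationV g : pz g^-1%g = - pz g.
Proof. by have := translationM g g^-1%g; rewrite mulgV translation1; lia. Qed.

Lemma translationX g k : pz (g ^+ k)%g = pz g *+ k.
Proof.
elim: k => [|k IHk]; first by rewrite translation1.
by rewrite expgS translationM IHk mulrS.
Qed.

(** Heights are unbounded along a ray to the end, so a cobounded action cannot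
    preserve them. *)
Lemma cobounded_translation (R : realType) (d : V -> V -> R) :
  d = path_metric E -> cobounded d act -> exists g, pz g != 0.
Proof.
move=> hd [B [[r Br] /seteqP[_ cov]]].
apply: contrapT => /forallNP pz0.
have {}pz0 g : pz g = 0 by apply/eqP; apply: contrapT => /negP; exact: pz0.
have [g0 _ [b0 Bb0 _]] := cov v0 I.
have bnd v : `|b v - b b0| %:~R <= r.
  have [g _ [w Bw <-]] := cov v I.
  rewrite hpz pz0 addr0; apply: le_trans (Br _ _ Bw Bb0).
  rewrite hd (path_metricE hE) [X in _ <= X]pmulrn ler_int.
  exact: level_lipschitz ho w b0.
have := bnd (iter (Num.truncn r).+1 par b0).
rewrite (level_iter ho) addrAC subrr add0r ger0_norm// => {}bnd.
have r0 : 0 <= r by apply: le_trans bnd; rewrite ler0z.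
have := truncn_itv r0 => /andP[_]; rewrite ltNge => /negP; apply.
by rewrite pmulrn.
Qed.

(** The vertices of the axis of t are those that t moves up their own ancestor
    line. Any v0 and t v0 have a common ancestor, from which on the ancestors
    of v0 have this property. *)
Lemma exists_axis_vertex t c : pz t = c%:Z ->
  exists x0, iter c par x0 = act t x0.
Proof.
move=> tc; exists (iter (dist v0 (act t v0)) par v0).
rewrite -iter_parJ -iterD addnC -[X in _ = iter X _ _]addn0.
by apply: (level_merge (hE := hE) ho) => //; rewrite hpz tc addr0.
Qed.

Lemma axis_powers t c x0 j : iter c par x0 = act t x0 ->
  iter (c * j) par x0 = act (t ^+ j)%g x0.
Proof.
move=> tx0; elim: j => [|j IHj]; first by rewrite muln0 expg0 ha.1.
by rewrite mulnS iterD IHj iter_parJ tx0 -ha.2 -expgSr.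
Qed.

(** An element z commuting with t preserves the axis of t: far up, z x0 and x0
    have the same ancestors, and a power of t moves this back to x0. *)
Lemma commuting_on_axis t c x0 z m n :
  (0 < c)%N -> iter c par x0 = act t x0 -> (t * z = z * t)%g ->
  pz z + n%:Z = m%:Z -> act z (iter n par x0) = iter m par x0.
Proof.
move=> c_gt0 tx0 tz zmn; set u := act z _; set v := iter m _ _.
pose j := dist u v.
have : iter (c * j + 0) par u = iter (c * j + 0) par v.
  apply: (level_merge (hE := hE) ho).
    by rewrite /u hpz !(level_iter ho) /=; lia.
  by rewrite leq_pmull.
rewrite addn0 {1}/u {1}/v iter_parJ -!iterD.
rewrite addnC iterD [in RHS]addnC [in RHS]iterD.
rewrite (axis_powers j tx0) !iter_parJ (act_commute ha) => [e|].
  by have := congr1 (act (t ^+ j)^-1%g) e; rewrite !(actK ha).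
by apply: commuteX; exact/esym.
Qed.

End OrientedAction.

(** * Walks in Cayley graphs *)

Section CayleyWalks.
Context {G : groupType} {A : set G}.
Implicit Types g h : G.

Lemma cayley_walk_translate k n g h :
  walk (cayley_adj A) n g h -> walk (cayley_adj A) n (k * g)%g (k * h)%g.
Proof.
apply: (walk_map (f := fun x => (k * x)%g)) => u v /asboolP uv.
by apply/asboolP; rewrite !invgM -!mulgA !mulKg.
Qed.

Lemma cayley_walk1 g : A g -> walk (cayley_adj A) 1 1%g g.
Proof.
by move=> Ag; apply: walk1; apply/asboolP; left; rewrite invg1 mul1g.
Qed.

Lemma cayley_walkM m n g h : walk (cayley_adj A) m 1%g g ->
  walk (cayley_adj A) n 1%g h -> walk (cayley_adj A) (m + n) 1%g (g * h)%g.
Proof.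
move=> wg wh; apply: walk_cat wg _.
by rewrite -[X in walk _ _ X _](mulg1 g); exact: cayley_walk_translate.
Qed.

Lemma cayley_walkX g k : A g -> walk (cayley_adj A) k 1%g (g ^+ k)%g.
Proof.
move=> Ag; elim: k => [|k IHk]; first by rewrite expg0.
by rewrite expgS -add1n; apply: cayley_walkM IHk; exact: cayley_walk1.
Qed.

Lemma cayley_connected :
  (forall g, exists n, walk (cayley_adj A) n 1%g g) ->
  graph_connected (cayley_adj A).
Proof.
move=> w1 g h; have [n /(cayley_walk_translate g)] := w1 (g^-1 * h)%g.
by rewrite mulg1 mulVKg => /walkP[p [pp lp _]]; exists p.
Qed.

End CayleyWalks.

(** * The stabilizer of a vertex of the axis *)

(** Z^n moves x0 along a single line: read with [k = 0] or [l = 0], this says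
    that climbing elements map x0 to its ancestors and that descending ones map
    x0 to a vertex having x0 as an ancestor. *)
Definition on_axis (V : Type) (par : V -> V) (G : groupType) (act : G -> V -> V)
    (pz : G -> int) (n : nat) (iota : 'rV[int]_n -> G) (x0 : V) :=
  forall z k l,
    pz (iota z) + k%:Z = l%:Z -> act (iota z) (iter k par x0) = iter l par x0.

Definition vertex_stab (V : Type) (G : groupType) (act : G -> V -> V)
    (H : set G) (x0 : V) : set G :=
  [set h | H h /\ act h x0 = x0].

Section Construction.
Context {R : realType} {V : eqType} {E : rel V} (hE : graph_connected E).
Context (sE : symmetric E).
Context {d : V -> V -> R} (hd : d = path_metric E).
Context {par : V -> V} {b : V -> int} (ho : oriented_to_end E par b).
Context {G : groupType} {act : G -> V -> V} (hact : simplicial_action E act).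
Context (parJ : forall g v, par (act g v) = act g (par v)).
Context {pz : G -> int} (hpz : translation_character b act pz).
Context {H : set G} {n : nat} {iota : 'rV[int]_n -> G}.
Context (hG : semidirect_Zn H iota) (pzH : forall h, H h -> pz h = 0).
Context {rho : 'rV[int]_n -> R} (hrho : forall z, rho z = (pz (iota z))%:~R).
Implicit Types (u v w : V) (g h : G) (z : 'rV[int]_n).
Local Notation dist := (gdist hE).

Let ha : is_action act. Proof. by case: hact. Qed.

Lemma exists_on_axis (v0 : V) z : 0 < pz (iota z) ->
  exists x0, on_axis par act pz iota x0.
Proof.
move=> z_gt0; pose c := `|pz (iota z)|%N.
have zc : pz (iota z) = c%:Z by rewrite /c gez0_abs // ltW.
have [x0 zx0] := exists_axis_vertex hE ho parJ hpz v0 zc.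
exists x0 => z' k l; apply: (commuting_on_axis hE ho hact parJ hpz _ zx0).
  by lia.
exact: (embeddingC hG).
Qed.

Context {x0 : V} (hx0 : on_axis par act pz iota x0).

Local Notation Q := (vertex_stab act H x0).

Let pzZD z1 z2 : pz (iota (z1 + z2)) = pz (iota z1) + pz (iota z2).
Proof. by rewrite (embeddingD hG) (translationM hact hpz x0). Qed.

Lemma axis_climb z : 0 <= pz (iota z) ->
  act (iota z) x0 = iter `|pz (iota z)|%N par x0.
Proof. by move=> z0; rewrite -[x0 in LHS]/(iter 0 par x0); apply: hx0; lia. Qed.

Lemma axis_dist z : (dist x0 (act (iota z) x0))%:Z = `|pz (iota z)|.
Proof.
have [z0|z0] := lerP 0 (pz (iota z)).
  by rewrite axis_climb // (dist_iter hE ho); lia.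
rewrite -{1}(_ : act (iota z) (iter `|pz (iota z)|%N par x0) = x0).
  by rewrite (act_gdist _ _ _ _ hact) (gdistC hE sE) (dist_iter hE ho); lia.
by rewrite -[RHS]/(iter 0 par x0); apply: hx0; lia.
Qed.

Lemma stab_subgroup : is_subgroup Q.
Proof.
have [H1 HV] := factor_subgroup hG; split; first by split => //; exact: ha.1.
move=> g h [Hg gx] [Hh hx]; split; first exact: HV.
by rewrite ha.2 -{1}hx (actK ha).
Qed.

(** Elements of Z^n that climb conjugate the stabilizer of x0 into itself,
    because what fixes a vertex fixes its ancestors. *)
Lemma stab_conj h z : Q h -> 0 <= rho z -> Q (h ^ iota z)%g.
Proof.
move=> [Hh hx]; rewrite hrho ler0z => z0.
split; first exact: (factor_normal hG).
rewrite conjgE !ha.2.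
have zx := axis_climb z0.
by rewrite zx -(iter_parJ parJ) hx -zx (actK ha).
Qed.

(** H preserves heights, so h x0 and x0 have a common ancestor at the same
    distance from both; h fixes it. *)
Lemma H_fixes_ancestor h : H h ->
  act h (iter (dist (act h x0) x0) par x0) = iter (dist (act h x0) x0) par x0.
Proof.
move=> Hh; rewrite -(iter_parJ parJ) -[in LHS](addn0 (dist _ _)).
rewrite -[in RHS](addn0 (dist _ _)).
by apply: (level_merge (hE := hE) ho) => //; rewrite hpz pzH // addr0.
Qed.

Lemma stab_absorbs h z : H h -> (dist (act h x0) x0)%:Z <= pz (iota z) ->
  Q (h ^ iota z)%g.
Proof.
move=> Hh hz; split; first exact: (factor_normal hG).
rewrite conjgE !ha.2.
have /axis_climb zx : 0 <= pz (iota z) by lia.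
rewrite {1}zx.
have -> : `|pz (iota z)|%N =
  (`|pz (iota z)| - dist (act h x0) x0 + dist (act h x0) x0)%N by lia.
rewrite iterD -(iter_parJ parJ) H_fixes_ancestor // -iterD subnK; last by lia.
by rewrite -zx (actK ha).
Qed.

(** A large power of a climbing element carries x0 past its common ancestor
    with h x0. *)
Lemma H_absorbed z1 h : 0 < pz (iota z1) -> H h ->
  exists z, 0 <= rho z /\ Q (h ^ iota z)%g.
Proof.
move=> z1_gt0 Hh; exists (z1 *+ dist (act h x0) x0).
have e : pz (iota (z1 *+ dist (act h x0) x0)) =
    pz (iota z1) *+ dist (act h x0) x0.
  by rewrite (embeddingX hG) (translationX hact hpz x0).
split; first by rewrite hrho ler0z e mulrn_wge0// ltW.
by apply: stab_absorbs => //; rewrite e -mulr_natr; nia.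
Qed.

Lemma stab_confining z1 : 0 < pz (iota z1) ->
  confining H iota rho Q.
Proof.
move=> z1_gt0; have [Q1 QV] := stab_subgroup.
have QVV h : Q h -> Q h^-1%g.
  by move=> Qh; rewrite -(mul1g h^-1%g); exact: QV.
split=> [h []//| | z z0 _ [h Qh <-] | h /(H_absorbed z1_gt0)[z [_ Qz]] | ].
- apply/seteqP; split=> [h Qh|_ [h Qh <-]]; last exact: QVV.
  by exists h^-1%g; [exact: QVV|rewrite invgK].
- exact: stab_conj.
- by exists z.
exists 0 => _ [_ [g Qg [h Qh <-]] <-]; rewrite (embedding0 hG) conjg1.
by rewrite -(invgK h); apply: QV => //; exact: QVV.
Qed.

Section QuasiIsometry.
Context {C : R} {ztop : 'rV[int]_n} (C_gt0 : 0 < C) (hC : C = rho ztop).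
Local Notation A := (Q `|` Z_rho iota rho C).
Local Notation cay := (cayley_adj A).

Let c := `|pz (iota ztop)|%N.
Let ztopE : pz (iota ztop) = c%:Z.
Proof. by move: C_gt0; rewrite hC hrho ltr0z => h; rewrite /c; lia. Qed.
Let c_gt0 : (0 < c)%N.
Proof. by move: C_gt0; rewrite hC hrho ltr0z ztopE; lia. Qed.
Let CE : C = c%:R. Proof. by rewrite hC hrho ztopE. Qed.

Lemma Z_generator z : `|pz (iota z)| <= c%:Z -> A (iota z).
Proof.
move=> zc; right; exists z => //=.
by rewrite hrho CE -intr_norm pmulrn ler_int.
Qed.

Lemma generator_displacement g : A g -> (dist x0 (act g x0) <= c)%N.
Proof.
move=> [[_ ->]|[z /= zC <-]]; first by rewrite gdistxx.
rewrite -lez_nat axis_dist.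
by move: zC; rewrite hrho CE -intr_norm pmulrn ler_int.
Qed.

Lemma walk_displacement k g h :
  walk cay k g h -> (dist (act g x0) (act h x0) <= c * k)%N.
Proof.
elim: k g => [g ->|k IHk g [g' gg' /IHk g'h]]; first by rewrite gdistxx.
rewrite mulnS.
apply: leq_trans (gdist_triangle hE (act g' x0) _ _) (leq_add _ g'h).
have step g1 g2 : A (g1^-1 * g2)%g -> (dist (act g1 x0) (act g2 x0) <= c)%N.
  move=> /generator_displacement; rewrite -(act_gdist hE g1 _ _ hact) -ha.2.
  by rewrite mulVKg.
by move: gg' => /asboolP[/step//|/step]; rewrite (gdistC hE sE).
Qed.

(** Induction on m: unless z is already a generator, one step by ztop or its
    opposite brings its displacement closer to zero. *)
Lemma Z_walk m z : `|pz (iota z)| <= m%:Z ->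
  exists2 k, (k <= m.+1)%N & walk cay k 1%g (iota z).
Proof.
elim: m z => [|m IHm] z zm.
  by exists 1%N => //; apply/cayley_walk1/Z_generator; lia.
have [zc|zc] := leP `|pz (iota z)| c%:Z.
  by exists 1%N => //; apply/cayley_walk1/Z_generator.
have pzB e : pz (iota (z - e)) = pz (iota z) - pz (iota e).
  by rewrite pzZD (embeddingN hG) (translationV hact hpz x0).
have ztopN : pz (iota (- ztop)) = - c%:Z.
  by rewrite (embeddingN hG) (translationV hact hpz x0) // ztopE.
have [e Ae ze] : exists2 e, A (iota e) & `|pz (iota (z - e))| <= m%:Z.
  have [z0|z0] := lerP 0 (pz (iota z)).
    by exists ztop; [apply: Z_generator|]; rewrite ?pzB ztopE; lia.
  by exists (- ztop); [apply: Z_generator|]; rewrite ?pzB ztopN; lia.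
have [k km wk] := IHm _ ze; exists k.+1 => //.
rewrite -(subrKC e z) (embeddingD hG) -add1n.
by apply: cayley_walkM wk; exact: cayley_walk1.
Qed.

(** If g = h z moves x0 by m, then h fixes an ancestor of x0, at most 2m steps
    up, where the rays from x0 and g x0 have met; hence h fixes T^2m x0 for
    T = ztop and is the conjugate of an element of the stabilizer by T^2m. *)
Lemma displacement_walk g : let m := dist x0 (act g x0) in
  exists2 k, (k <= 5 * m + 2)%N & walk cay k 1%g g.
Proof.
move=> m; have [h [z [Hh gE]]] := semidirect_decomposition hG g.
have pgz : pz g = pz (iota z).
  by rewrite gE (translationM hact hpz x0) // pzH // add0r.
have zm : `|pz (iota z)| <= m%:Z.
  have := level_lipschitz hE ho x0 (act g x0).
  by rewrite hpz pgz opprD addNKr normrN.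
have [k km wz] := Z_walk zm.
pose T := (iota ztop ^+ (2 * m))%g.
have Tx : act T x0 = iter (c * (2 * m)) par x0.
  rewrite /T -(embeddingX hG) -[x0 in LHS]/(iter 0 par x0); apply: hx0.
  rewrite (embeddingX hG) (translationX hact hpz x0) // ztopE.
  by rewrite addr0 -mulr_natr natz.
(* The positive and negative parts of the displacement of z. *)
have [a [a' [aE am]]] : exists a a' : nat,
    pz (iota z) + a'%:Z = a%:Z /\ (a <= m)%N.
  have [z0|z0] := lerP 0 (pz (iota z)).
    by exists `|pz (iota z)|%N, 0%N; lia.
  by exists 0%N, `|pz (iota z)|%N; lia.
have hfix : act h (iter (m + a) par x0) = iter (m + a) par x0.
  rewrite -{1}(hx0 (z := z) (k := (m + a')%N)); last by lia.
  rewrite -ha.2 -gE -(iter_parJ parJ).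
  apply: (level_merge (hE := hE) ho); first by rewrite hpz pgz -addrA aE.
  by rewrite (gdistC hE sE).
have QT : Q (h ^ T)%g.
  split; first exact: (factor_normal hG).
  rewrite conjgE !ha.2 Tx.
  have -> : (c * (2 * m) = (c * (2 * m) - (m + a)) + (m + a))%N by nia.
  rewrite iterD -(iter_parJ parJ) hfix -iterD subnK; last by nia.
  by rewrite -Tx (actK ha).
exists (2 * m + (1 + (2 * m + k)))%N; first by lia.
have -> : g = (T * ((h ^ T) * (T^-1 * iota z)))%g.
  by rewrite conjgE gE -!mulgA mulVKg mulVKg.
apply: cayley_walkM.
  by apply: cayley_walkX; apply: Z_generator; rewrite ztopE.
apply: cayley_walkM; first by apply: cayley_walk1; left.
apply: cayley_walkM => //; rewrite /T -expVgn -(embeddingN hG).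
apply: cayley_walkX; apply: Z_generator.
by rewrite (embeddingN hG) (translationV hact hpz x0) // ztopE; lia.
Qed.

(** The constant 5 is the slope in [displacement_walk]; c bounds the
    displacement of x0 by a generator; r bounds the diameter of a set whose
    translates cover the tree. *)
Lemma orbit_map_quasi_isometry (hcob : cobounded d act) :
  equivariantly_qi_to_cayley d act A.
Proof.
have hcay : graph_connected cay.
  apply: cayley_connected => g.
  by have [k _ wk] := displacement_walk g; exists k.
split => //; exists (act^~ x0); split=> [g h|]; first exact: ha.2.
have [B [[r Br] /seteqP[_ cov]]] := hcob.
exists (c%:R + 5), (`|r| + 1); split.
- by rewrite ltr_wpDl.
- by rewrite addr_ge0.
- move=> g h; rewrite /word_metric (path_metricE hcay) hd (path_metricE hE).
  set m := dist _ _; set w := gdist _ _ _.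
  have mw : (m <= c * w)%N by apply: walk_displacement; exact: gdist_walk.
  have wm : (w <= 5 * m + 2)%N.
    have := displacement_walk (g^-1 * h)%g; rewrite /=.
    have -> : dist x0 (act (g^-1 * h)%g x0) = m.
      by rewrite /m -(act_gdist hE g x0 _ hact) -ha.2 mulVKg.
    move=> [k km /(cayley_walk_translate g)]; rewrite mulg1 mulVKg => wk.
    exact: leq_trans (gdist_le hcay wk) km.
  have c5 : 0 < c%:R + 5 :> R by rewrite ltr_wpDl.
  apply/andP; split.
    rewrite lerBlDr ler_pdivrMl //.
    apply: (@le_trans _ _ (5 * m%:R + 2)).
      by rewrite -natrM -natrD ler_nat.
    have := normr_ge0 r; have := ler0n R c; have := ler0n R m; nra.
  apply: (@le_trans _ _ (c%:R * w%:R)); first by rewrite -natrM ler_nat.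
  have := normr_ge0 r; have := ler0n R c; have := ler0n R w; nra.
- move=> v; have [g _ [u Bu <-]] := cov v I.
  have [g' _ [u' Bu' g'u']] := cov x0 I.
  exists (g * g'^-1)%g; apply: le_trans (_ : r <= _); last first.
    by rewrite (le_trans (ler_norm r))// lerDl.
  apply: le_trans (Br _ _ Bu' Bu).
  rewrite hd !(path_metricE hE) -g'u' -ha.2 mulgVK.
  by rewrite (act_gdist _ _ _ _ hact).
Qed.

End QuasiIsometry.
End Construction.

(** * The repelling end of the axis *)

Section GromovProducts.
Context {R : realType} {V : eqType} {E : rel V} (hE : graph_connected E).
Context (sE : symmetric E).
Context {d : V -> V -> R} (hd : d = path_metric E).
Implicit Types o x y : V.

Lemma metric_triangle y x z : d x z <= d x y + d y z.
Proof. by rewrite hd !(path_metricE hE) -natrD ler_nat gdist_triangle. Qed.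

Lemma metricC x y : d x y = d y x.
Proof. by rewrite hd !(path_metricE hE) (gdistC hE sE). Qed.

Lemma gromov_product_base o' o x y :
  gromov_product d o' x y - d o o' <= gromov_product d o x y.
Proof.
have := metric_triangle o o' x; have := metric_triangle o o' y.
rewrite (metricC o' o) /gromov_product; lra.
Qed.

Lemma gromov_product_move x' o x y :
  gromov_product d o x' y - d x' x <= gromov_product d o x y.
Proof.
have := metric_triangle x o x'; have := metric_triangle x' x y.
rewrite (metricC x x') /gromov_product; lra.
Qed.

End GromovProducts.

(** A sequence descending the axis: for climbing z it converges to the end of
    the axis opposite to xi. *)
Definition orbit_descent (V : Type) (G : groupType) (act : G -> V -> V)
    (n : nat) (iota : 'rV[int]_n -> G) (x0 : V) (z : 'rV[int]_n)
    (i : nat) : V :=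
  act (iota (- (z *+ i))) x0.

Section AxisBackwards.
Context {R : realType} {V : choiceType} {E : rel V} (hE : graph_connected E).
Context (sE : symmetric E).
Context {d : V -> V -> R} (hd : d = path_metric E).
Context {par : V -> V} {b : V -> int} (ho : oriented_to_end E par b).
Context {G : groupType} {act : G -> V -> V} (hact : simplicial_action E act).
Context (parJ : forall g v, par (act g v) = act g (par v)).
Context {pz : G -> int} (hpz : translation_character b act pz).
Context {H : set G} {n : nat} {iota : 'rV[int]_n -> G}.
Context (hG : semidirect_Zn H iota) (pzH : forall h, H h -> pz h = 0).
Context {x0 : V} (hx0 : on_axis par act pz iota x0).
Context {z1 : 'rV[int]_n} (z1_gt0 : 0 < pz (iota z1)).
Implicit Types (u v w : V) (g h : G) (z : 'rV[int]_n).
Local Notation dist := (gdist hE).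
Local Notation descent := (orbit_descent act iota x0 z1).
Local Notation repelling_point := (boundary_class d descent).

Let ha : is_action act. Proof. by case: hact. Qed.
Let c := `|pz (iota z1)|%N.
Let c_gt0 : (0 < c)%N. Proof. by rewrite /c; lia. Qed.

Lemma descent_iter i j : iter (c * j) par (descent (i + j)) = descent i.
Proof.
rewrite /orbit_descent (iter_parJ parJ).
have -> : iota (- (z1 *+ i)) = (iota (- (z1 *+ (i + j))) * iota (z1 *+ j))%g.
  by rewrite -(embeddingD hG) mulrnDr opprD addrNK.
rewrite ha.2; congr act; apply/esym.
rewrite -[x0 in LHS]/(iter 0 par x0); apply: hx0.
by rewrite (embeddingX hG) (translationX hact hpz x0) /c -mulr_natr natz; nia.
Qed.

Lemma descent0 : descent 0 = x0.
Proof. by rewrite /orbit_descent mulr0n oppr0 (embedding0 hG) ha.1. Qed.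

Lemma descent_base i : iter (c * i) par (descent i) = x0.
Proof. by rewrite -[RHS]descent0 -(descent_iter 0 i). Qed.

Lemma descent_dist i j : dist (descent (i + j)) (descent i) = (c * j)%N.
Proof. by rewrite -(descent_iter i j) (dist_iter hE ho). Qed.

Lemma descent_dist_base i : dist x0 (descent i) = (c * i)%N.
Proof. by rewrite (gdistC hE sE) -(descent_dist 0 i) descent0. Qed.

Lemma descent_gromov i j : (i <= j)%N ->
  gromov_product d x0 (descent i) (descent j) = (c * i)%:R.
Proof.
move=> /subnKC <-; set k := (j - i)%N.
rewrite /gromov_product hd !(path_metricE hE) !descent_dist_base.
by rewrite (gdistC hE sE) descent_dist mulnDr natrD; lra.
Qed.

Lemma descent_converges : converges_at_infinity d descent.
Proof.
move=> o M; pose N := (Num.truncn `|M + d o x0|).+1; exists N => i j Ni Nj.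
have le_Mi k : (N <= k)%N -> M + d o x0 <= (c * k)%:R.
  move=> Nk; apply: le_trans (ler_norm _) _.
  have /andP[_ /ltW h] := truncn_itv (normr_ge0 (M + d o x0)).
  by apply: le_trans h _; rewrite ler_nat (leq_trans Nk)// leq_pmull.
apply: le_trans (gromov_product_base hE sE hd x0 o _ _).
rewrite lerBrDr; have [ij|/ltnW ji] := leqP i j.
  by rewrite descent_gromov// le_Mi.
have -> : gromov_product d x0 (descent i) (descent j) =
          gromov_product d x0 (descent j) (descent i).
  rewrite /gromov_product (metricC hE sE hd (descent i) (descent j)); lra.
by rewrite descent_gromov// le_Mi.
Qed.

Lemma repelling_descent : repelling_point descent.
Proof. by split; exact: descent_converges. Qed.

Lemma repelling_boundary : gromov_boundary d repelling_point.
Proof. by exists descent => //; exact: descent_converges. Qed.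

Lemma repelling_limit : limit_set d act repelling_point.
Proof.
split; first exact: repelling_boundary.
by exists x0, (fun i => iota (- (z1 *+ i))); exact: repelling_descent.
Qed.

(** If h moves x0 then it moves every descent i, and the geodesic from
    descent i to its image climbs above x0, so that the Gromov products of the
    two sequences at x0 stay bounded. *)
Lemma fixed_repelling_stab h : fixes_boundary_point act repelling_point ->
  H h -> act h x0 = x0.
Proof.
move=> /(_ h) hfix Hh; apply: contrapT => hx.
(* If h moves x0 by D, then the products at equal indices are at most
   D / 2 - 1. *)
have [_ /(_ x0 ((dist x0 (act h x0))%:R / 2))[N hN]] :
    repelling_point (fun i => act h (descent i)).
  by rewrite -hfix; exists descent => //; exact: repelling_descent.
have {hN} := hN N N (leqnn _) (leqnn _); apply/negP; rewrite -ltNge.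
rewrite /gromov_product hd !(path_metricE hE) descent_dist_base.
set D := dist x0 (act h x0); set D1 := dist x0 _; set D2 := dist _ _.
have D1le : (D1 <= D + c * N)%N.
  apply: leq_trans (gdist_triangle hE (act h x0) _ _) _.
  by rewrite leq_add2l (act_gdist _ _ _ _ hact) descent_dist_base.
have [k [l [kl e]]] :=
  walk_merge ho (gdist_walk hE (descent N) (act h (descent N))).
have kleq : k = l.
  by have /(congr1 b) := e; rewrite !(level_iter ho) hpz pzH //; lia.
have kN : (c * N < k)%N.
  rewrite ltnNge; apply/negP => kN; apply: hx.
  have : iter (c * N - k + k) par (act h (descent N)) =
      iter (c * N - k + k) par (descent N).
    by rewrite !iterD {2}kleq e.
  by rewrite subnK // (iter_parJ parJ) descent_base.
have D2ge : (2 * (c * N) + 2 <= D2)%N by rewrite /D2; lia.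
have : (c * N + D1 + 2 <= D2 + D)%N by lia.
rewrite -(ler_nat R) !natrD; lra.
Qed.

(** An element g = h z moves the terms of the descent by the same distance as
    x0, since all of them lie in the orbit of x0 under Z^n, which H fixes. *)
Lemma stab_fixed_repelling : (forall h, H h -> act h x0 = x0) ->
  fixes_boundary_point act repelling_point.
Proof.
move=> Hx0.
have act_sub g : boundary_act act g repelling_point `<=` repelling_point.
  move=> _ [u [ucv udiv] <-].
  have gpJ o x y : gromov_product d o (act g x) (act g y) =
      gromov_product d (act g^-1%g o) x y.
    rewrite /gromov_product hd !(path_metricE hE) (act_gdist _ _ _ _ hact).
    by rewrite -{1 2}(actKV ha g o) !(act_gdist _ _ _ _ hact).
  split=> o M.
    have [N hN] := ucv (act g^-1%g o) M.
    by exists N => i j Ni Nj; rewrite gpJ hN.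
  have [h [z [Hh gE]]] := semidirect_decomposition hG g^-1%g.
  have hZ z' : act h (act (iota z') x0) = act (iota z') x0.
    by rewrite -ha.2 conjgC ha.2 Hx0 //; exact: (factor_normal hG).
  have gdesc i : d (descent i) (act g^-1%g (descent i)) = d x0 (act g^-1%g x0).
    have zdesc : act g^-1%g (descent i) =
        act (iota (- (z1 *+ i))) (act (iota z) x0).
      rewrite gE ha.2 /orbit_descent -(ha.2 (iota z)) -(embeddingD hG) hZ addrC.
      by rewrite (embeddingD hG) ha.2.
    rewrite zdesc gE ha.2 hZ hd !(path_metricE hE).
    by rewrite (act_gdist _ _ _ _ hact).
  have [N hN] := udiv (act g^-1%g o) (M + d x0 (act g^-1%g x0)).
  exists N => i j Ni Nj; rewrite -[descent i](actKV ha g) gpJ.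
  apply: le_trans (gromov_product_move hE sE hd (descent i) _ _ _).
  by rewrite gdesc lerBrDr hN.
move=> g; apply/seteqP; split; first exact: act_sub.
move=> u hu; exists (fun i => act g^-1%g (u i)).
  by apply: (act_sub g^-1%g); exists u.
by apply/funext => i; rewrite (actKV ha).
Qed.

(** From x0, the next vertex towards xi lies above x0 while every descent i
    lies below. *)
Lemma repelling_not_parent (xi : set (nat -> V)) :
  parent_towards hE xi par -> ~ xi descent.
Proof.
move=> hpar /(hpar x0)[N /(_ N (leqnn N))[_]].
rewrite descent_dist_base (gdistC hE sE).
rewrite -[X in par X](descent_base N) -iterS (dist_iter hE ho); lia.
Qed.

End AxisBackwards.

(** * Cobounded actions on trees fixing a boundary point *)

Theorem proposition2p16 (R : realType) (G : groupType) (H : set G) (n : nat)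
    (iota : 'rV[int]_n -> G) (hG : semidirect_Zn H iota)
    (V : choiceType) (E : rel V) (htree : is_tree E)
    (act : G -> V -> V) (hact : simplicial_action E act)
    (d : V -> V -> R) (hd : d = path_metric E)
    (hcob : cobounded d act)
    (htype : oriented_lineal d act \/ quasi_parabolic d act)
    (xi : set (nat -> V)) (hxi : gromov_boundary d xi)
    (hfix : fixes_boundary_point act xi)
    (s : nat -> V) (hs : xi s) (x : V)
    (p : G -> R) (hp : p = busemann_pseudocharacter d act s x)
    (hpH : forall h, H h -> p h = 0)
    (rho : 'rV[int]_n -> R) (hrho : rho = p \o iota) :
  [/\ zmod_morphism rho,
      exists z, rho z != 0,
      forall h z, H h -> p (h * iota z)%g = rho z,
      discrete_character rho &
      forall (a : 'I_n -> 'rV[int]_n) (C : R),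
        generates_Zn a -> admissible_constant rho a C ->
        exists Q : set G,
          [/\ confining H iota rho Q,
              is_subgroup Q,
              equivariantly_qi_to_cayley d act (Q `|` Z_rho iota rho C),
              oriented_lineal d act -> Q = H &
              quasi_parabolic d act -> strictly_confining H iota rho Q]].
Proof.
have [_ sE _ hE _] := htree.
have [par hpar] := exists_parent htree hE hd hxi.
have [b hb] := exists_level htree hpar hs x.
have ho : oriented_to_end E par b.
  split=> [v|v w|v].
  - exact: (adj_parent_towards hpar hs).
  - exact: (parent_towards_or_from htree hpar hs).
  - exact: (level_parent hpar hs v hb).
have [ha aE] := hact.
have parJ g v : par (act g v) = act g (par v).
  apply: (parent_equivariant htree hpar hs) => [u w|u w|].
  - exact: act_gdist.
  - exact: aE.
  - by rewrite -(hfix g); exists s.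
have hpz := exists_translation_character hE ho parJ x.
set pz := (fun g => _) in hpz.
have qE g : busemann_quasimorphism d act s x g = (pz g)%:~R.
  rewrite (busemann_quasimorphism_level hd _ _ hb).
  by rewrite /pz (level_base hb) subr0.
have pE g : p g = (pz g)%:~R.
  rewrite hp busemann_pseudocharacter_hom // => m.
  by rewrite !qE (translationX hact hpz x) raddfMn mulr_natl.
have pzH h : H h -> pz h = 0.
  by move=> /hpH/eqP; rewrite pE intr_eq0 => /eqP.
have rhoE z : rho z = (pz (iota z))%:~R by rewrite hrho /= pE.
have pzZB : zmod_morphism (pz \o iota).
  move=> u v /=.
  rewrite (embeddingD hG) (embeddingN hG).
  by rewrite (translationM hact hpz x) (translationV hact hpz x).
have [z1 z1_gt0] : exists z, 0 < pz (iota z).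
  have [g pzg] := cobounded_translation hE ho hpz x hd hcob.
  have [h [z [Hh gE]]] := semidirect_decomposition hG g.
  have pzz : pz (iota z) != 0.
    by move: pzg; rewrite gE (translationM hact hpz x) pzH // add0r.
  have [z0|z0] := ltrP 0 (pz (iota z)); first by exists z.
  exists (- z); rewrite (embeddingN hG) (translationV hact hpz x).
  by rewrite oppr_gt0 lt_neqAle pzz.
have [x0 hx0] := exists_on_axis hE ho hact parJ hpz hG x z1_gt0.
split.
- by move=> u v; rewrite !rhoE -intrB; congr _%:~R; exact: pzZB.
- by exists z1; rewrite rhoE intr_eq0 gt_eqF.
- by move=> h z Hh; rewrite pE rhoE (translationM hact hpz x) pzH // add0r.
- have [|c /seteqP[cl cr]] := int_range_cyclic pzZB.
    by exists z1; rewrite /= gt_eqF.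
  exists c%:~R; apply/seteqP; split=> [_ [z _ <-]|_ [k _ <-]].
    have [k _ /= ck] := cl _ (imageT (pz \o iota) z).
    by exists k => //; rewrite rhoE -ck mulrzz mulrzA.
  have [w _ /= wk] := cr _ (imageT (fun k => c *~ k) k).
  by exists w => //; rewrite rhoE wk mulrzz mulrzA.
move=> a C _ [C_gt0 _ [ztop hC]].
have Qconf := stab_confining hE ho hact parJ hpz hG pzH rhoE hx0 z1_gt0.
exists (vertex_stab act H x0); split=> //.
- exact: (stab_subgroup hact hG).
- exact: (orbit_map_quasi_isometry hE sE hd ho hact parJ hpz hG pzH rhoE hx0
            C_gt0 hC hcob).
- move=> [_ limfix]; apply/seteqP; split=> [h []//|h Hh]; split=> //.
  have eta_fix := limfix _
    (repelling_limit hE sE hd ho hact parJ hpz hG hx0 z1_gt0).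
  exact: (fixed_repelling_stab hE sE hd ho hact parJ hpz hG pzH hx0 z1_gt0
            eta_fix Hh).
move=> [_ [xi0 [_ xi0_unique]]]; split=> //.
apply: contrapT => /forallNP not_strict.
(* No conjugate of the stabilizer is strictly smaller, so conjugation by a
   climbing element maps it onto itself, and what it absorbs lies in it. *)
have Hx0 h : H h -> act h x0 = x0.
  move=> Hh; have [z [z0 Qhz]] :=
    H_absorbed hE ho hact parJ hpz hG pzH rhoE hx0 z1_gt0 Hh.
  have [_ _ conjQ _ _] := Qconf.
  have : vertex_stab act H x0 `<=` conj_set (vertex_stab act H x0) (iota z).
    by apply: contrapT => nQ; apply: (not_strict z); split=> //; exact: conjQ.
  by move=> /(_ _ Qhz)[q [_ qx] /conjg_inj <-].
have eta_fix := stab_fixed_repelling hE sE hd hact hG (z1 := z1) Hx0.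
have eta_bd := repelling_boundary hE sE hd ho hact parJ hpz hG hx0 z1_gt0.
(* The repelling end is then fixed by G, hence it is xi by uniqueness. *)
have eta_xi : boundary_class d (orbit_descent act iota x0 z1) = xi.
  rewrite -(xi0_unique _ (conj hxi hfix)).
  by rewrite (xi0_unique _ (conj eta_bd eta_fix)).
apply: (repelling_not_parent sE ho hact parJ hpz hG hx0 z1_gt0 hpar).
rewrite -eta_xi.
exact: (repelling_descent hE sE hd ho hact parJ hpz hG hx0 z1_gt0).
Qed.
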